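(* The value of the ''guessing a random function'' game is $1$. That is, $$\inf_{(\Omega,\mathcal{F},\mathbf{P},f)}\ \sup_{g}\ \gamma^{\rm Bard}(f,g)=1=\sup_{\beta}\ \inf_{(\Omega,\mathcal{F},\mathbf{P},f)}\ \gamma^{\rm Bard}\bigl(f,\beta(\Omega,\mathcal{F},\mathbf{P},f)\bigr),$$ where the infima are over all choices of Aqua, the first supremum is over all responses $g$ of Bard to the given choice of Aqua, and the second supremum is over all maps $\beta$ that assign to each choice of Aqua a response of Bard to it.
   Context: The game is a two-player zero-sum game between Aqua and Bard, in which Bard maximizes and Aqua minimizes Bard's payoff. Choices of Aqua: Aqua selects a probability space $(\Omega,\mathcal{F},\mathbf{P})$ and a jointly measurable function $f:\Omega\times[0,1)\to\{a,b\}$; write $f_\omega=f(\omega,\cdot)$. This choice is told to Bard. Nature then selects $\omega\in\Omega$ according to $\mathbf{P}$, and Bard is not informed of $\omega$. Responses of Bard: knowing Aqua's choice (but not $\omega$), Bard selects a finite partition $0=t_0<t_1<\dots<t_K=1$. Then, for $k=0,1,\dots,K-1$ successively, Bard selects the restriction of her guess to $[t_k,t_{k+1})$, after which the restriction of $f_\omega$ to $[t_k,t_{k+1})$ is announced to her. Thus a response amounts to a partition together with a jointly measurable function $g:\Omega\times[0,1)\to\{a,b\}$ such that for every $k$ the restriction of $g(\omega,\cdot)$ to $[t_k,t_{k+1})$ depends on $\omega$ only through the restriction of $f_\omega$ to $[0,t_k)$ (if $f_\omega=f_{\omega'}$ on $[0,t_k)$ then $g(\omega,\cdot)=g(\omega',\cdot)$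 on $[t_k,t_{k+1})$). Payoff: $$\gamma^{\rm Bard}(f,g)=\mathbf{E}\left[\int_0^1 \mathbf{1}_{\{f(\omega,t)=g(\omega,t)\}}\,dt\right]=(\mathbf{P}\otimes\mathrm{Leb})\bigl(\{(\omega,t)\in\Omega\times[0,1) : f(\omega,t)=g(\omega,t)\}\bigr).$$ *)

(* Defs.v *)
From HB Require Import structures.
From mathcomp Require Import all_boot all_order all_algebra.
From mathcomp Require Import all_classical all_reals all_analysis.

Set Implicit Arguments.
Unset Strict Implicit.
Unset Printing Implicit Defensive.
Import Order.TTheory GRing.Theory Num.Theory.

Local Open Scope classical_set_scope.
Local Open Scope ring_scope.

(* The two-point set {a, b} is encoded as [bool]. The functions of the game
   live on Omega x [0, 1[; they are represented by functions on Omega x R whose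
   values at times outside [0, 1[ are never looked at. Times carry the Borel
   sigma-algebra. *)
Definition jointly_measurable (R : realType) (d : measure_display)
    (T : measurableType d) (f : T -> R -> bool) : Prop :=
  @measurable_fun _ _ (T * measurableTypeR R)%type bool ([set: T] `*` `[0, 1[)
    (fun z => f z.1 z.2).

Record aqua_choice (R : realType) := AquaChoice {
  aqua_disp : measure_display;
  aqua_space : measurableType aqua_disp;
  aqua_prob : probability aqua_space R;
  aqua_fun : aqua_space -> R -> bool;
  aqua_fun_meas : jointly_measurable aqua_fun }.
Arguments aqua_fun {R} A w t : rename.

(* [s = [:: t_1; ...; t_K]] lists the division points after [t_0 = 0], so that
   [t_k = nth 1 (0 :: s) k]. *)
Definition nonanticipating (R : realType) (T : Type) (s : seq R)
    (f g : T -> R -> bool) : Prop :=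
  forall k : nat, (k < size s)%N -> forall w w' : T,
    {in `[0, nth 1 (0 :: s) k[, f w =1 f w'} ->
    {in `[nth 1 (0 :: s) k, nth 1 (0 :: s) k.+1[, g w =1 g w'}.

Record bard_response (R : realType) (A : aqua_choice R) := BardResponse {
  bard_part : seq R;
  bard_partP : itv_partition 0 1 bard_part;
  bard_fun : aqua_space A -> R -> bool;
  bard_fun_meas : jointly_measurable bard_fun;
  bard_funP : nonanticipating bard_part (aqua_fun A) bard_fun }.
Arguments bard_fun {R A} B w t : rename.

Definition payoff (R : realType) (A : aqua_choice R) (B : bard_response A) :
    \bar R :=
  (\int[aqua_prob A]_w \int[lebesgue_measure]_(t in `[0%R, 1%R[)
     (\1_[set u | aqua_fun A w u = bard_fun B w u] t)%:E)%E.

(* Main.v *)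
Require Import Defs.
From HB Require Import structures.
From mathcomp Require Import all_boot all_order all_algebra.
From mathcomp Require Import all_classical all_reals all_analysis.
From mathcomp Require Import measurable_realfun lra.

Set Implicit Arguments.
Unset Strict Implicit.
Unset Printing Implicit Defensive.
Import Order.TTheory GRing.Theory Num.Theory.
Import numFieldNormedType.Exports.

Local Open Scope classical_set_scope.
Local Open Scope ereal_scope.

(** A payoff is the measure of a subset of Omega x [0, 1[, hence at most [1]
    ([payoff_le1]). For the lower bound, Bard repeats the past with a short
    delay: she cuts [0, 1[ into [n + 1] blocks of length [h = 1 / (n + 1)]
    and guesses [f_w (t - h)] at time [t] (and [false] while [t < h]). On a
    block this only looks at the values of [f_w] on the preceding block, so it
    is a legal response ([delay_response]).

    Translation is continuous in [L^1], so for each fixed [w] the times at which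
    a measurable [f_w] differs from its delayed copy have a measure that tends
    to [0] with [h]. In [delay_agree_ge] this is obtained from inner regularity
    and translation invariance: up to a small measure, [t] and [t - h] both lie
    in the union of a compact subset of [{f_w = true}] and a compact subset of
    [{f_w = false}]; these are disjoint compact sets, and a translation by a
    small [h] cannot carry a point of one into the other.

    By Tonelli the payoff is the expectation of the measure of the section at
    [w] of the agreement set, so dominated convergence over [Omega] gives
    payoffs that converge to [1] ([payoff_delay_cvg]). Thus every choice of Aqua
    has a response of payoff at least [1 - e]; picking one for each choice gives
    a strategy that guarantees [1 - e], which settles both orders of inf and
    sup. *)

(** * Measurability *)

Section measurability.
Context d (T : measurableType d).

Lemma measurable_agree (D : set T) (f g : T -> bool) :
  measurable D -> measurable_fun D f -> measurable_fun D g ->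
  measurable (D `&` [set x | f x = g x]).
Proof.
move=> mD mf mg.
have -> : D `&` [set x | f x = g x] = \bigcup_(b in [set: bool])
    ((D `&` f @^-1` [set b]) `&` (D `&` g @^-1` [set b])).
  apply/seteqP; split=> [x [Dx fg]|x [b _ [[Dx fb] [_ gb]]]].
    by exists (f x).
  by split=> //=; rewrite fb gb.
apply: fin_bigcup_measurable => // b _.
by apply: measurableI; [exact: mf|exact: mg].
Qed.

(** The guard [p] keeps [s x] inside [D]: [f] is only measurable on [D], so
    [f \o s] alone could fail to be measurable. *)
Lemma measurable_guarded_comp (D : set T) (s : T -> T) (p f : T -> bool) :
  measurable D -> measurable_fun D s -> measurable_fun D p ->
  (forall x, D x -> p x -> D (s x)) -> measurable_fun D f ->
  measurable_fun D (fun x => p x && f (s x)).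
Proof.
move=> mD ms mp Ds mf; apply: (measurable_fun_bool true).
rewrite [X in measurable X](_ : _ = (D `&` p @^-1` [set true]) `&`
    (D `&` s @^-1` (D `&` f @^-1` [set true]))); last first.
  apply/seteqP; split=> [x [Dx /andP[px fx]]|x [[Dx px] [_ [_ fx]]]].
    by split; split => //; split => //; exact: Ds.
  by split=> //=; rewrite px fx.
by apply: measurableI; [exact: mp|apply: ms => //; exact: mf].
Qed.

Lemma measurable_section (R : realType) (f : T -> R -> bool) w :
  jointly_measurable f ->
  @measurable_fun _ _ (measurableTypeR R) bool `[0%R, 1%R[ (f w).
Proof.
move=> mf; apply: (measurable_fun_bool true).
have mD : measurable
    ([set: T] `*` `[0%R, 1%R[ : set (T * measurableTypeR R)%type).
  by apply: measurableX => //; exact: measurable_itv.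
have /(measurable_xsection w) := mf mD [set true] I.
congr measurable; apply/seteqP; split => t; rewrite /xsection/= inE /=.
  by move=> [[]].
by move=> [].
Qed.

End measurability.

(** * Agreement of a function with its delayed copy *)

Section delay_agreement.
Context {R : realType}.
Implicit Types (h t : R) (f : R -> bool).

Definition delay h f t := (h <= t)%R && f (t - h)%R.

Lemma measurable_fun_subr h (D : set (measurableTypeR R)) :
  measurable_fun D (fun t : measurableTypeR R => (t - h)%R : measurableTypeR R).
Proof.
exact: (@measurable_funB _ (measurableTypeR R) R D id (cst h)).
Qed.

Lemma measurable_delay h f : (0 <= h)%R ->
  @measurable_fun _ _ (measurableTypeR R) bool `[0%R, 1%R[ f ->
  @measurable_fun _ _ (measurableTypeR R) bool `[0%R, 1%R[ (delay h f).
Proof.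
move=> h0 mf; apply: (@measurable_guarded_comp _ (measurableTypeR R) _
  (fun t => (t - h)%R)) => //.
- exact: measurable_fun_subr.
- exact: measurable_fun_ler.
- by move=> x /=; rewrite !in_itv/= => /andP[? ?] ?; apply/andP; split; lra.
Qed.

Lemma jointly_measurable_delay d (T : measurableType d) (f : T -> R -> bool) h :
  (0 <= h)%R -> jointly_measurable f ->
  jointly_measurable (fun w => delay h (f w)).
Proof.
move=> h0 mf; rewrite /jointly_measurable /delay.
apply: (@measurable_guarded_comp _ (T * measurableTypeR R)%type _
  (fun z => (z.1, (z.2 - h)%R)) (fun z => (h <= z.2)%R)
  (fun z => f z.1 z.2)) => //.
- exact: measurableX.
- apply: measurable_funTS; apply: measurable_fun_pair => //.
  exact: (@measurable_funB _ (T * measurableTypeR R)%type R setT snd (cst h)).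
- by apply: measurable_fun_ler => //; apply: measurable_funTS.
- move=> [w x] /=; rewrite !in_itv/= => -[_ /andP[? ?]] ?.
  by split => //; apply/andP; split; lra.
Qed.

Lemma lebesgue_measure_unit_itv :
  lebesgue_measure (`[0%R, 1%R[%classic : set (measurableTypeR R)) = 1.
Proof. by rewrite lebesgue_measure_itv/= lte01 oppr0 adde0. Qed.

(** The image of Lebesgue measure under a translation has the same value on the
    half-open intervals, which determine a measure. *)
Lemma lebesgue_measure_translate h (A : set (measurableTypeR R)) :
  measurable A ->
  lebesgue_measure ((fun t => (t - h)%R) @^-1` A) = lebesgue_measure A.
Proof.
move=> mA; pose s (t : measurableTypeR R) : measurableTypeR R := (t - h)%R.
have ms : measurable_fun setT s by exact: measurable_fun_subr.
apply/esym.
apply: (@lebesgue_measure_unique R (pushforward lebesgue_measure s)) => // X.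
move=> [[a b] _ <-] /=; rewrite /pushforward /s.
rewrite (_ : _ @^-1` _ = `](a + h)%R, (b + h)%R]%classic); last first.
  apply/seteqP; split => x /=; rewrite !in_itv/= => /andP[? ?];
  by apply/andP; split; lra.
rewrite !lebesgue_measure_itv/= !lte_fin ltrD2r.
by case: ifP => // _; rewrite -!EFinB; congr EFin; lra.
Qed.

(** Disjoint sets, one compact and one closed, are at positive distance. Each
    [x] in [K] has a neighborhood that small translations keep out of [L], and
    finitely many of these neighborhoods cover [K]. *)
Lemma near_translate_disjoint (K L : set R) : compact K -> closed L ->
  (forall x, K x -> ~ L x) ->
  \forall h \near (0 : R)%R, forall x, K x -> ~ L (x - h)%R.
Proof.
move=> /compact_near_coveringP cK cL KL.
apply: (cK R (nbhs (0 : R)%R) (fun h x => ~ L (x - h)%R)) => x Kx.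
have sub_cvg : ((z.1 - z.2)%R @[z --> (x, (0 : R)%R)] --> (x - 0)%R).
  by apply: cvgB; [exact: cvg_fst|exact: cvg_snd].
apply: (sub_cvg (~` L)); rewrite subr0.
by apply: open_nbhs_nbhs; split; [exact: closed_openC|exact: KL].
Qed.

(** With compact sets [K b] inside the level sets of [f] and [M] the part of
    [0, 1[ that they miss, a time [t > h] at which [f] and its delayed copy
    differ has [t] or [t - h] in [M]. The exceptional times thus lie in
    [0, h], in [M], or in the translate of [M]. The error [e] is split into
    five parts: one for [0, h], and one for each of the two level sets in
    [M] and in its translate. *)
Lemma delay_agree_ge f (e : R) :
  @measurable_fun _ _ (measurableTypeR R) bool `[0%R, 1%R[ f -> (0 < e)%R ->
  \forall h \near (0 : R)%R, (0 <= h)%R ->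
    1 <= lebesgue_measure (`[0%R, 1%R[ `&` [set t | f t = delay h f t]) + e%:E.
Proof.
move=> mf e0; pose D : set (measurableTypeR R) := `[0%R, 1%R[.
pose level b := D `&` f @^-1` [set b].
have mlevel b : measurable (level b) by exact: mf.
have inner b : exists K : set R, [/\ compact K, K `<=` level b &
    lebesgue_measure (level b `\` K) < (e / 5)%:E].
  apply: lebesgue_regularity_inner; [exact: mlevel| |lra].
  apply: (@le_lt_trans _ _ (lebesgue_measure D)); last first.
    by rewrite lebesgue_measure_unit_itv ltry.
  apply: le_measure => [|//=|]; rewrite ?inE;
    [exact: mlevel|exact: measurable_itv|exact: subIsetl].
have [K KP] := choice inner.
have mK b : measurable (K b : set (measurableTypeR R)).
  by have [? _ _] := KP b; exact: compact_measurable.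
pose M := (level true `\` K true) `|` (level false `\` K false).
have mlK b : measurable (level b `\` K b) by exact: measurableD.
have mM : measurable M by exact: measurableU.
have M_small : lebesgue_measure M <= (2 * (e / 5))%:E.
  rewrite (le_trans (measureU2 _ _ _))// mulr_natl mulr2n EFinD.
  by rewrite leeD// ltW//; have [] := KP true; have [] := KP false.
have apart b :
    \forall h \near (0 : R)%R, forall x, K b x -> ~ K (~~ b) (x - h)%R.
  have [cK Kl _] := KP b; have [cK' Kl' _] := KP (~~ b).
  apply: near_translate_disjoint => //; first exact: compact_closed.
  by move=> x /Kl[_ /= fx] /Kl'[_ /=]; rewrite fx; case: (b).
near=> h => h0.
have small : (h <= e / 5)%R.
  by move: h0; near: h; apply: lt_nbhsl_le; rewrite divr_gt0.
have apart_h b x : K b x -> ~ K (~~ b) (x - h)%R.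
  by move: b x; case; near: h; exact: apart.
set G := (X in lebesgue_measure X).
have mG : measurable G by apply: measurable_agree => //; exact: measurable_delay.
pose M' : set (measurableTypeR R) := (fun t => (t - h)%R) @^-1` M.
have cover : D `<=` G `|` (`[0%R, h] `|` (M `|` M')).
  move=> t Dt; have [th|ht] := leP t h.
    by right; left; move: Dt; rewrite /D/= !in_itv/= th andbT => /andP[].
  have Dth : D (t - h)%R.
    move: Dt; rewrite /D/= !in_itv/= => /andP[? ?]; apply/andP.
    by split; lra.
  have inKM u : D u -> K (f u) u \/ M u.
    move=> Du; have [Ku|nKu] := pselect (K (f u) u); first by left.
    by right; move: nKu; case fu: (f u) => nKu; [left|right].
  have [Kt|] := inKM _ Dt; last by right; right; left.
  have [Kth|] := inKM _ Dth; last by right; right; right.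
  left; split => //=; rewrite /delay (ltW ht)/=.
  have := apart_h _ _ Kt.
  by case: (f t) (f (t - h)%R) Kth => -[].
have mM' : measurable M'.
  by rewrite -[M']setTI; exact: measurable_fun_subr.
have mMM' : measurable (M `|` M') by exact: measurableU.
have mcover : measurable (`[0%R, h] `|` (M `|` M')) by exact: measurableU.
have start_small : lebesgue_measure
    (`[0%R, h]%classic : set (measurableTypeR R)) <= (e / 5)%:E.
  rewrite lebesgue_measure_itv/= lte_fin; case: ifP => _.
    by rewrite oppr0 adde0 lee_fin.
  by rewrite lee_fin; lra.
rewrite -[X in X <= _]lebesgue_measure_unit_itv.
apply: le_trans (le_measure _ _ _ cover) _.
- by rewrite inE; exact: measurable_itv.
- by rewrite inE; exact: measurableU.
rewrite (le_trans (measureU2 _ _ _))// leeD2l//.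
rewrite (le_trans (measureU2 _ _ _))//.
have -> : e%:E = (e / 5)%:E + ((2 * (e / 5))%:E + (2 * (e / 5))%:E).
  by rewrite -!EFinD; congr EFin; lra.
apply: leeD; first exact: start_small.
rewrite (le_trans (measureU2 _ _ _))//; apply: leeD; first exact: M_small.
rewrite (_ : _ M' = lebesgue_measure M)//.
exact: lebesgue_measure_translate.
Unshelve. all: by end_near.
Qed.

End delay_agreement.

(** * The delayed response *)

Section delayed_play.
Context {R : realType}.

Definition regular_partition n : seq R :=
  [seq (k%:R / n.+1%:R)%R | k <- iota 1 n.+1].

Lemma nth_regular_partition n k : (k <= n.+1)%N ->
  nth 1%R (0%R :: regular_partition n) k = (k%:R / n.+1%:R)%R.
Proof.
move=> kn; rewrite -[X in X :: _](mul0r (n.+1%:R^-1)%R).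
rewrite -[X in (X * _)%R]/(0%:R)%R.
rewrite -[_ :: _]/[seq (j%:R / n.+1%:R)%R | j <- iota 0 n.+2].
by rewrite (nth_map 0%N) ?size_iota// nth_iota.
Qed.

Lemma regular_partitionP n : itv_partition 0%R 1%R (regular_partition n).
Proof.
have F0 : (0%:R / n.+1%:R = 0 :> R)%R by rewrite mul0r.
split.
- rewrite -[X in path _ X]F0.
  apply: (@homo_path _ _ (fun k => k%:R / n.+1%:R)%R ltn).
    by move=> i j ij; rewrite ltr_pM2r ?invr_gt0 ?ltr0n// ltr_nat.
  exact: (iota_ltn_sorted 0 n.+2).
- rewrite (last_nth 1%R) size_map size_iota nth_regular_partition//.
  by rewrite divff// pnatr_eq0.
Qed.

(** The delay is the length of a block, so at any time of a block the delayed
    time lies before that block. *)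
Lemma nonanticipating_delay n (T : Type) (f : T -> R -> bool) :
  nonanticipating (regular_partition n) f (fun w => delay n.+1%:R^-1%R (f w)).
Proof.
move=> k; rewrite size_map size_iota => kn w w' ff' t.
rewrite !nth_regular_partition// 1?ltnW// in ff' *.
rewrite !in_itv/= => /andP[kt tk]; rewrite /delay; case: (leP _ t) => //= ht.
apply: ff'; rewrite in_itv/= subr_ge0 ht/= ltrBlDr.
by rewrite (lt_le_trans tk)// -natr1 mulrDl mul1r.
Qed.

Lemma block_length_ge0 n : (0 <= n.+1%:R^-1 :> R)%R.
Proof. by rewrite invr_ge0. Qed.

Definition delay_response (A : aqua_choice R) (n : nat) : bard_response A :=
  BardResponse (regular_partitionP n)
    (jointly_measurable_delay (block_length_ge0 n) (@aqua_fun_meas _ A))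
    (@nonanticipating_delay n _ (aqua_fun A)).

End delayed_play.

(** * Payoffs *)

Section payoffs.
Context {R : realType}.
Implicit Type A : aqua_choice R.

Definition agreement A (B : bard_response A) :
    set (aqua_space A * measurableTypeR R) :=
  ([set: aqua_space A] `*` `[0%R, 1%R[) `&`
  [set z | aqua_fun A z.1 z.2 = bard_fun B z.1 z.2].

Lemma measurable_agreement A (B : bard_response A) : measurable (agreement B).
Proof.
apply: measurable_agree.
- by apply: measurableX => //; exact: measurable_itv.
- exact: (@aqua_fun_meas _ A).
- exact: (@bard_fun_meas _ _ B).
Qed.

Lemma xsection_agreement A (B : bard_response A) w :
  xsection (agreement B) w =
  `[0%R, 1%R[ `&` [set t | aqua_fun A w t = bard_fun B w t].
Proof.
by apply/seteqP; split => t; rewrite /xsection/= inE => -[[]] // => [_ ? ?|? ? ?].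
Qed.

(** The set under the indicator in [payoff] also contains times outside
    [0, 1[, where measurability is not assumed; intersecting with [0, 1[ first
    makes the inner integral a Lebesgue measure. *)
Lemma payoffE A (B : bard_response A) :
  payoff B = \int[aqua_prob A]_w lebesgue_measure (xsection (agreement B) w).
Proof.
apply: eq_integral => w _.
have mx : measurable (xsection (agreement B) w).
  by apply: measurable_xsection; exact: measurable_agreement.
rewrite xsection_agreement in mx *.
transitivity (\int[lebesgue_measure]_(t in `[0%R, 1%R[)
    (\1_(`[0%R, 1%R[ `&` [set u | aqua_fun A w u = bard_fun B w u]) t)%:E).
  apply: eq_integral => t tD.
  by rewrite !indicE in_setI (_ : (t \in `[0%R, 1%R[%classic) = true).
by rewrite integral_indic//; rewrite setIAC setIid.
Qed.

Lemma measure_xsection_agreement_le1 A (B : bard_response A) w :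
  lebesgue_measure (xsection (agreement B) w) <= 1.
Proof.
rewrite -[leRHS](@lebesgue_measure_unit_itv R); apply: le_measure; rewrite ?inE.
- by apply: measurable_xsection; exact: measurable_agreement.
- exact: measurable_itv.
- by rewrite xsection_agreement; exact: subIsetl.
Qed.

Lemma integral_prob_cst1 A : \int[aqua_prob A]_w cst 1 w = 1.
Proof. by rewrite integral_cst// mul1e; exact: probability_setT. Qed.

Lemma payoff_le1 A (B : bard_response A) : payoff B <= 1.
Proof.
rewrite payoffE -[leRHS](integral_prob_cst1 A).
apply: ge0_le_integral => //.
- by apply: measurable_fun_xsection; exact: measurable_agreement.
- by move=> w _; exact: measure_xsection_agreement_le1.
Qed.

Lemma measure_agreement_delay_cvg A w :
  lebesgue_measure (xsection (agreement (delay_response A n)) w)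
    @[n --> \oo] --> (1 : \bar R).
Proof.
have fin n : lebesgue_measure (xsection (agreement (delay_response A n)) w)
    \is a fin_num.
  rewrite ge0_fin_numE//; apply: (@le_lt_trans _ _ 1); last exact: ltry.
  by rewrite measure_xsection_agreement_le1.
apply/fine_cvgP; split; first exact: nearW.
have mf := measurable_section w (@aqua_fun_meas _ A).
apply/cvgrPdist_le => e e0; near=> n.
have : 1 <= lebesgue_measure (xsection (agreement (delay_response A n)) w)
    + e%:E.
  rewrite xsection_agreement.
  suff : (0 <= harmonic n :> R)%R.
    by near: n; exact: cvg_harmonic (delay_agree_ge mf e0).
  exact: block_length_ge0.
have := measure_xsection_agreement_le1 (delay_response A n) w.
rewrite /= -(fineK (fin n)) -EFinD !lee_fin => le1 ge1.
by rewrite ger0_norm ?subr_ge0//; lra.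
Unshelve. all: by end_near.
Qed.

Lemma payoff_delay_cvg A :
  payoff (delay_response A n) @[n --> \oo] --> (1 : \bar R).
Proof.
rewrite -[X in _ --> X](integral_prob_cst1 A); under eq_cvg do rewrite payoffE.
apply: (@dominated_cvg _ _ _ _ _ measurableT _ _ (cst 1)) => //.
- by move=> n; apply: measurable_fun_xsection; exact: measurable_agreement.
- by move=> w _; exact: measure_agreement_delay_cvg.
- exact: finite_measure_integrable_cst.
- by move=> n w _; rewrite gee0_abs//; exact: measure_xsection_agreement_le1.
Qed.

Lemma exists_near_optimal_response (e : R) : (0 < e)%R ->
  forall A, exists B : bard_response A, 1 <= payoff B + e%:E.
Proof.
move=> e0 A; apply: contrapT => /forallNP low.
have : (1 : \bar R) <= 1 - e%:E.
  apply: (cvge_le _ (payoff_delay_cvg A)); apply: nearW => n.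
  by rewrite leeBrDr//; apply: ltW; rewrite ltNge; apply/negP; exact: low.
by rewrite -EFinB lee_fin; lra.
Qed.

(** An infimum over an empty set of choices would be [+oo], so the upper bounds
    on the value need some choice of Aqua. *)
Definition constant_choice : aqua_choice R.
Proof.
apply: (@AquaChoice R _ unit (@dirac _ unit tt R) (fun _ _ => true)).
exact: measurable_cst.
Defined.

End payoffs.

(** * The value of the game *)

Theorem corollary2p2 (R : realType) :
  ereal_inf [set x : \bar R | exists A : aqua_choice R,
    x = ereal_sup [set y : \bar R | exists g : bard_response A,
      y = payoff g]] = 1
  /\
  1 = ereal_sup [set x : \bar R |
    exists beta : (forall A : aqua_choice R, bard_response A),
      x = ereal_inf [set y : \bar R | exists A : aqua_choice R,
        y = payoff (beta A)]].
Proof.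
split; apply/eqP; rewrite eq_le; apply/andP; split.
- apply: (le_trans (y := ereal_sup [set y |
      exists g : bard_response (@constant_choice R), y = payoff g])).
    by apply: ereal_inf_lbound; exists constant_choice.
  by apply/ereal_supP => _ [g ->]; exact: payoff_le1.
- apply/ereal_infP => _ [A ->]; apply/lee_addgt0Pr => e e0.
  have [B /le_trans] := exists_near_optimal_response e0 A; apply.
  by rewrite leeD2r//; apply: ereal_sup_ubound; exists B.
- apply/lee_addgt0Pr => e e0.
  have [beta beta_opt] : exists beta : forall A : aqua_choice R, bard_response A,
      forall A, 1 <= payoff (beta A) + e%:E.
    exists (fun A => projT1 (cid (exists_near_optimal_response e0 A))) => A.
    exact: projT2 (cid (exists_near_optimal_response e0 A)).
  rewrite -leeBlDr//.
  apply: (le_trans (y := ereal_inf [set y | exists A, y = payoff (beta A)])).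
    by apply/ereal_infP => _ [A ->]; rewrite leeBlDr.
  by apply: ereal_sup_ubound; exists beta.
- apply/ereal_supP => _ [beta ->].
  apply: le_trans (payoff_le1 (beta constant_choice)).
  by apply: ereal_inf_lbound; exists constant_choice.
Qed.
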